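(* Let $L$ be a congruence normal lattice, obtained by a sequence of doublings $L_0,\ L_1=L_0[C_0],\ \dots,\ L_m=L_{m-1}[C_{m-1}]\cong L$, where $L_0$ is the one-element lattice and each $C_i$ is a non-empty convex subset of $L_i$. (a) $L$ is join-extremal if and only if $L$ is join-congruence uniform and at each doubling step one doubles a lower pseudo-interval that contains an element of the spine (that is, for every $i<m$, $C_i$ is a lower pseudo-interval of $L_i$ containing an element of the spine of $L_i$). (b) $L$ is extremal if and only if $L$ is congruence uniform and at each doubling step one doubles an interval that contains an element of the spine (that is, for every $i<m$, $C_i$ is an interval of $L_i$ containing an element of the spine of $L_i$).
   Context: All lattices are finite. The length $\ell(L)$ is the maximum length of a chain in $L$, where a chain with $r+1$ elements has length $r$. The spine of $L$ is the set of elements lying on at least one chain of length $\ell(L)$. $\mathrm{JIrr}(L)$ (resp. $\mathrm{MIrr}(L)$) is the set of elements covering (resp. covered by) exactly one element. $L$ is join-extremal if $\ell(L)=|\mathrm{JIrr}(L)|$, meet-extremal if $\ell(L)=|\mathrm{MIrr}(L)|$, and extremal if it is both. A subset $C\subseteq L$ is convex if $x,y\in C$ implies $[x,y]\subseteq C$. It is a lower pseudo-interval if it is a union of intervals sharing the same minimum element. Let $I_L(C)=\{y\in L\mid \exists x\in C,\ y\le x\}$ and let $C_2^{\mathrm{ch}}$ be the two-element chain $0<1$. For a convex subset $C$ of $L$, the doubling $L[C]$ is the subposet of $L\times C_2^{\mathrm{ch}}$ on the subset $\big(I_L(C)\times\{0\}\big)\sqcup\big[\big((L\setminus I_L(C))\cup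 C\big)\times\{1\}\big]$; it is a lattice. A lattice is congruence normal if it is (up to isomorphism) obtained from the one-element lattice by successive doublings of convex subsets; it is join-congruence uniform if it can be so obtained by doubling a lower pseudo-interval at each step, and congruence uniform if it can be so obtained by doubling an interval at each step. *)

(* Defs.v *)
From HB Require Import structures.
From mathcomp Require Import all_boot all_order.

Set Implicit Arguments.
Unset Strict Implicit.
Unset Printing Implicit Defensive.

Import Order.TTheory.
Local Open Scope order_scope.

Section Posets.
Context {d : Order.disp_t} {L : finPOrderType d}.
Implicit Types (x y z : L) (S C : {set L}).

Definition is_chain S : bool := [forall x in S, forall y in S, x >=< y].

(* The maximum is taken in [nat]; a chain with r + 1 elements counts for r. *)
Definition poset_length : nat :=
  (\max_(S : {set L} | is_chain S) #|S|.-1)%N.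

Definition spine : {set L} :=
  [set x | [exists S : {set L},
              [&& is_chain S, #|S|.-1 == poset_length & x \in S]]].

Definition covered_by x y : bool :=
  (x < y) && [forall z : L, ~~ (x < z < y)].

Definition JIrr : {set L} := [set x | #|[set y | covered_by y x]| == 1%N].
Definition MIrr : {set L} := [set x | #|[set y | covered_by x y]| == 1%N].

Definition join_extremal : Prop := poset_length = #|JIrr|.
Definition meet_extremal : Prop := poset_length = #|MIrr|.
Definition extremal : Prop := join_extremal /\ meet_extremal.

Definition closed_itv x y : {set L} := [set z | x <= z <= y].

Definition is_interval C : Prop :=
  exists x y, x <= y /\ C = closed_itv x y.

Definition convex C : Prop :=
  forall x y, x \in C -> y \in C -> closed_itv x y \subset C.

Definition lower_pseudo_interval C : Prop :=
  exists x (B : {set L}),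
    [/\ B != set0, forall y, y \in B -> x <= y
      & C = \bigcup_(y in B) closed_itv x y].

Definition order_ideal C : {set L} := [set y | [exists x in C, y <= x]].

(* [bool], ordered by [false < true], is the two-element chain; [L *p bool]
   carries the componentwise order, which the subtype [doubling C] inherits. *)
Definition doubling_set C : {set L *p bool} :=
  setX (order_ideal C) [set false] :|: setX (~: order_ideal C :|: C) [set true].

Definition doubling C : Type := {u : L *p bool | u \in doubling_set C}.

HB.instance Definition _ C := SubFinite.on (doubling C).
HB.instance Definition _ C :=
  [SubChoice_isSubPOrder of doubling C by <: with d].

End Posets.

Arguments poset_length {d} L.
Arguments spine {d} L.
Arguments JIrr {d} L.
Arguments MIrr {d} L.
Arguments join_extremal {d} L.
Arguments meet_extremal {d} L.
Arguments extremal {d} L.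

Definition order_isomorphic d d' (S : porderType d) (T : porderType d') : Prop :=
  exists f : S -> T, bijective f /\ {mono f : x y / x <= y}.

(* [finTBLatticeType] is the type of nonempty finite lattices. Only the terms
   [Ls i] with [i <= m] and the sets [C i] with [i < m] matter. *)
Definition doubling_sequence d (m : nat) (Ls : nat -> finTBLatticeType d)
    (C : forall i, {set Ls i}) (L : finTBLatticeType d) : Prop :=
  [/\ #|Ls 0%N| = 1%N,
      forall i, (i < m)%N -> C i != set0,
      forall i, (i < m)%N -> convex (C i),
      forall i, (i < m)%N -> order_isomorphic (Ls i.+1) (doubling (C i))
    & order_isomorphic (Ls m) L].

Definition congruence_normal d (L : finTBLatticeType d) : Prop :=
  exists m (Ls : nat -> finTBLatticeType d) (C : forall i, {set Ls i}),
    doubling_sequence m C L.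

Definition join_congruence_uniform d (L : finTBLatticeType d) : Prop :=
  exists m (Ls : nat -> finTBLatticeType d) (C : forall i, {set Ls i}),
    doubling_sequence m C L /\
    forall i, (i < m)%N -> lower_pseudo_interval (C i).

Definition congruence_uniform d (L : finTBLatticeType d) : Prop :=
  exists m (Ls : nat -> finTBLatticeType d) (C : forall i, {set Ls i}),
    doubling_sequence m C L /\
    forall i, (i < m)%N -> is_interval (C i).

(* Main.v *)
(** Doubling a nonempty convex set [C] lengthens a lattice by 1 if [C] meets the
    spine and by 0 otherwise, while it adds exactly one join-irreducible per
    minimal element of [C] and one meet-irreducible per maximal element.  After
    [m] steps the length is thus at most [m] and the numbers of irreducibles at
    least [m]; equality forces every step to meet the spine and to double a set
    with a unique minimal (resp. maximal) element, which for convex sets means a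
    lower pseudo-interval (resp. its dual). *)
Require Import Defs.
From HB Require Import structures.
From mathcomp Require Import all_boot all_order.

Section Doublings.
Set Implicit Arguments.
Unset Strict Implicit.
Import Order.TTheory.
Local Open Scope order_scope.

(** * Minimal and maximal elements of a subset *)

Section Minimal.

Definition minimals d (L : finPOrderType d) (C : {set L}) : {set L} :=
  [set x in C | [forall y in C, ~~ (y < x)]].

Definition maximals d (L : finPOrderType d) (C : {set L}) : {set L} :=
  [set x in C | [forall y in C, ~~ (x < y)]].

Variables (d : Order.disp_t) (L : finPOrderType d).
Implicit Types (x y z : L) (S C : {set L}).

Lemma minimalsP C x :
  reflect (x \in C /\ forall y, y \in C -> ~~ (y < x)) (x \in minimals C).
Proof.
rewrite inE; apply: (iffP andP) => -[xC].
  by move/forall_inP.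
by move=> h; split=> //; apply/forall_inP.
Qed.

Lemma maximals_dual C : @minimals _ L^d C = maximals C.
Proof. by apply/setP => x; rewrite !inE. Qed.

Lemma minimal_below C x : x \in C -> exists2 y, y \in minimals C & y <= x.
Proof.
move=> xC.
(* Among the elements of [C] below [x], one with the fewest elements below it is minimal in [C]. *)
have Px : (x \in C) && (x <= x) by rewrite xC /=.
have [y /andP[yC yx] ymin] := @arg_minnP L x
  (fun y => (y \in C) && (y <= x)) (fun y => #|[set z | z <= y]|) Px.
exists y => //; apply/minimalsP; split=> // z zC; apply/negP => zy.
have := ymin z; rewrite zC (le_trans (ltW zy) yx) => /(_ isT).
rewrite leqNgt => /negP; apply; apply: proper_card; apply/properP; split.
  by apply/subsetP => w; rewrite !inE => /le_trans; apply; apply: ltW.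
by exists y; rewrite inE ?lexx // lt_geF.
Qed.

End Minimal.

(** * Covers, duality and least elements *)

Section Covers.
Variables (d : Order.disp_t) (L : finPOrderType d).
Implicit Types (x y z : L) (S C : {set L}).

Lemma maximal_above C x : x \in C -> exists2 y, y \in maximals C & x <= y.
Proof.
move=> xC; have [y] := @minimal_below _ L^d C x xC.
by rewrite maximals_dual; exists y.
Qed.

Lemma covered_byP x y :
  reflect (x < y /\ forall z, x < z -> z < y -> False) (covered_by x y).
Proof.
apply: (iffP andP) => -[xy].
  by move=> /forallP h; split=> // z xz zy; have := h z; rewrite xz zy.
by move=> h; split=> //; apply/forallP => z; apply/negP => /andP[/h].
Qed.

Lemma covered_by_dual x y : @covered_by _ L^d x y = covered_by y x.
Proof.
by rewrite /covered_by; congr andb; apply: eq_forallb => z; rewrite andbC.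
Qed.

(** Duality exchanges lower and upper covers; the count of meet-irreducibles will thus follow from
    that of join-irreducibles. *)
Lemma JIrr_dual : JIrr L^d = MIrr L :> {set L}.
Proof.
apply/setP => x; rewrite !inE; congr (_ == _); apply: eq_card => y.
by rewrite !inE covered_by_dual.
Qed.

(** A maximal element among those at least [x] and strictly below [y] is covered by [y]. *)
Lemma cover_between x y : x < y -> exists2 z, x <= z & covered_by z y.
Proof.
move=> xy.
have xS : x \in [set z | x <= z < y] by rewrite inE lexx.
have [z] := maximal_above xS.
rewrite !inE => /andP[/andP[xz zy] /forall_inP zmax] _.
exists z => //; apply/covered_byP; split=> // w zw wy.
have := zmax w; rewrite inE wy zw (le_trans xz (ltW zw)) => /(_ isT).
by [].
Qed.

Lemma card_minimals_gt0 C : C != set0 -> (0 < #|minimals C|)%N.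
Proof.
move=> /set0Pn[x /minimal_below[y ym _]].
by apply/card_gt0P; exists y.
Qed.

Lemma card_maximals_gt0 C : C != set0 -> (0 < #|maximals C|)%N.
Proof.
move=> /set0Pn[x /maximal_above[y ym _]].
by apply/card_gt0P; exists y.
Qed.

Lemma minimals_least C x :
  x \in C -> (forall y, y \in C -> x <= y) -> minimals C = [set x].
Proof.
move=> xC xle; apply/setP => y; rewrite inE; apply/minimalsP/eqP => [[yC]|->].
  by move=> /(_ x xC); have := xle y yC; rewrite le_eqVlt => /orP[/eqP|->].
by split=> // z /xle /le_gtF ->.
Qed.

(** Every element of [C] lies above a minimal one, so a unique minimal element is a least
    element. *)
Lemma card_minimals1P C :
  reflect (exists2 x, x \in C & forall y, y \in C -> x <= y)
    (#|minimals C| == 1%N).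
Proof.
apply: (iffP cards1P) => -[x].
  move=> mC; exists x => [|y /minimal_below[z]].
    by have : x \in minimals C; [rewrite mC set11 | case/minimalsP].
  by rewrite mC inE => /eqP ->.
by move=> xC xle; exists x; apply: minimals_least.
Qed.

End Covers.

(** * Pseudo-intervals and intervals among convex sets *)

Section Intervals.
Variables (d : Order.disp_t) (L : finPOrderType d).
Implicit Types (x y z : L) (S C : {set L}).

Lemma card_maximals1P C :
  reflect (exists2 x, x \in C & forall y, y \in C -> y <= x)
    (#|maximals C| == 1%N).
Proof. by rewrite -maximals_dual; apply: (@card_minimals1P _ L^d C). Qed.

Lemma lower_pseudo_intervalP C :
  C != set0 -> convex C -> lower_pseudo_interval C <-> #|minimals C| = 1%N.
Proof.
move=> C0 Cconv; split.
  case=> x [B [B0 xB CE]]; apply/eqP/card_minimals1P; exists x.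
    by case/set0Pn: B0 => y yB; rewrite CE; apply/bigcupP; exists y;
       rewrite // inE lexx xB.
  by move=> y; rewrite CE => /bigcupP[z _]; rewrite inE => /andP[].
(* The upper ends of the intervals may be taken to be all elements of [C]; convexity keeps the union
   inside [C]. *)
move=> /eqP/card_minimals1P[x xC xle]; exists x, C; split=> //.
apply/setP => y; apply/idP/bigcupP => [yC|[z zC]].
  by exists y; rewrite // inE lexx xle.
exact/subsetP/Cconv.
Qed.

Lemma is_intervalP C : convex C ->
  is_interval C <-> #|minimals C| = 1%N /\ #|maximals C| = 1%N.
Proof.
move=> Cconv; split.
  case=> x [y [xy ->]]; split; apply/eqP.
    apply/card_minimals1P; exists x; rewrite ?inE ?lexx // => z.
    by rewrite inE => /andP[].
  apply/card_maximals1P; exists y; rewrite ?inE ?xy ?lexx // => z.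
  by rewrite inE => /andP[].
case=> /eqP/card_minimals1P[x xC xle] /eqP/card_maximals1P[y yC yge].
exists x, y; split; first exact: xle.
apply/setP => z; apply/idP/idP => [zC|]; first by rewrite inE xle ?yge.
exact/subsetP/Cconv.
Qed.

End Intervals.

(** * Longest chains and the spine *)

Section Chains.
Variables (d : Order.disp_t) (L : finPOrderType d).
Implicit Types (x y z : L) (S C : {set L}).

Lemma is_chainP S :
  reflect {in S &, forall x y, x >=< y} (is_chain S).
Proof.
apply: (iffP forall_inP) => [h x y xS yS|h x xS].
  by have /forall_inP := h x xS; apply.
by apply/forall_inP => y; apply: h.
Qed.

Lemma chain_card_le S : is_chain S -> (#|S| <= (poset_length L).+1)%N.
Proof.
move=> Sch; apply: leq_trans (leqSpred _) _; rewrite ltnS.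
exact: (@leq_bigmax_cond _ (@is_chain _ L) (fun S => #|S|.-1) S Sch).
Qed.

Lemma poset_length_le n :
  (forall S, is_chain S -> #|S| <= n.+1)%N -> (poset_length L <= n)%N.
Proof.
by move=> h; apply/bigmax_leqP => S /h; case: #|S|.
Qed.

(** The point [x0] rules out the empty poset, which also has length 0 but no one-element chain. *)
Lemma longest_chain (x0 : L) :
  exists2 S : {set L}, is_chain S & #|S| = (poset_length L).+1.
Proof.
have c1 : @is_chain _ L [set x0].
  by apply/is_chainP => x y; rewrite !inE => /eqP-> /eqP->; exact: comparablexx.
have [S Sch Smax] := @arg_maxnP _ _ (@is_chain _ L) (fun S => #|S|) c1.
exists S => //; apply/eqP; rewrite eqn_leq chain_card_le //=.
have S0 : (0 < #|S|)%N by have := Smax _ c1; rewrite cards1.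
rewrite -(prednK S0) ltnS; apply: poset_length_le => T /Smax.
by rewrite prednK.
Qed.

Lemma spineP x :
  reflect
    (exists S : {set L},
       [/\ is_chain S, #|S| = (poset_length L).+1 & x \in S])
    (x \in spine L).
Proof.
rewrite inE; apply: (iffP existsP) => -[S].
  case/and3P=> Sch /eqP Sl xS; exists S; split=> //.
  by rewrite -Sl prednK //; apply/card_gt0P; exists x.
by case=> Sch Sl xS; exists S; rewrite Sch Sl xS eqxx.
Qed.

End Chains.

(* A presentation of the doubling that is symmetric under order duality: each
   element of [D] is the lower copy [low x] or the upper copy [up x] of an
   element [x] of [L], and the two copies coincide outside [C].  For [C = set0]
   it describes an isomorphism. *)
Record is_doubling {d d' : Order.disp_t} {L : finPOrderType d}
    {D : finPOrderType d'} (C : {set L}) (p : D -> L) (low up : L -> D) :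
    Prop := IsDoubling {
  proj_low : cancel low p;
  proj_up : cancel up p;
  low_or_up : forall u, u = low (p u) \/ u = up (p u);
  low_leE : {mono low : x y / x <= y};
  up_leE : {mono up : x y / x <= y};
  low_le_up : forall x y, (low x <= up y) = (x <= y);
  up_le_low : forall x y,
    (up x <= low y) = (x <= y) && ~~ ((x \in C) && (y \in C)) }.

(** * Order relations between the two copies *)

Section IsDoubling.
Variables (d d' : Order.disp_t) (L : finPOrderType d) (D : finPOrderType d').
Variables (C : {set L}) (p : D -> L) (low up : L -> D).
Hypothesis dbl : is_doubling C p low up.
Implicit Types (x y z : L) (u v w : D).

Let pl : cancel low p := proj_low dbl.
Let pu : cancel up p := proj_up dbl.

(** Reversing the order swaps the lower and the upper copies. *)
Lemma doubling_dual : @is_doubling _ _ L^d D^d C p up low.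
Proof.
case: dbl => ? ? cases ll uu lu ul; split=> //.
- by move=> u; case: (cases u); [right | left].
- by move=> x y; exact: uu.
- by move=> x y; exact: ll.
- by move=> x y; exact: lu.
- by move=> x y; rewrite [(x \in C) && _]andbC; exact: ul.
Qed.

Lemma up_out x : x \notin C -> up x = low x.
Proof.
move=> xC; apply/le_anti.
by rewrite (up_le_low dbl) (low_le_up dbl) lexx (negbTE xC).
Qed.

Lemma low_lt_up x : x \in C -> low x < up x.
Proof.
by move=> xC; rewrite lt_leAnge (low_le_up dbl) (up_le_low dbl) lexx xC.
Qed.

Lemma proj_mono u v : u <= v -> p u <= p v.
Proof.
case: (low_or_up dbl u) (low_or_up dbl v) => -> [] ->; rewrite !(pl, pu).
- by rewrite (low_leE dbl).
- by rewrite (low_le_up dbl).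
- by rewrite (up_le_low dbl) => /andP[].
- by rewrite (up_leE dbl).
Qed.

Lemma low_proj_le u : low (p u) <= u.
Proof.
by case: (low_or_up dbl u) => ->; rewrite !(pl, pu) // (low_le_up dbl).
Qed.

Lemma le_up_proj u : u <= up (p u).
Proof.
by case: (low_or_up dbl u) => ->; rewrite !(pl, pu) // (low_le_up dbl).
Qed.

Lemma low_ltE : {mono low : x y / x < y}.
Proof. exact: leW_mono (low_leE dbl). Qed.

Lemma up_ltE : {mono up : x y / x < y}.
Proof. exact: leW_mono (up_leE dbl). Qed.

(** * Lower covers and join-irreducibles of a doubling *)

Lemma lt_low_proj u x : u < low x -> p u < x.
Proof.
move=> ux; rewrite lt_neqAle -{2}(pl x) proj_mono ?(ltW ux) // andbT.
apply: contraTneq ux => <-; apply/negP => /lt_geF.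
by rewrite low_proj_le.
Qed.

(** For [y < x] this is the greatest element over [y] below [low x]; when [y] is outside [C] both
    branches agree. *)
Let lift x y := if x \in C then low y else up y.

Lemma lift_lt_low x y : (lift x y < low x) = (y < x).
Proof.
rewrite /lift; case: ifPn => [_|/up_out <-].
  exact: low_ltE.
exact: up_ltE.
Qed.

Lemma lt_low_lift x v : v < low x -> v <= lift x (p v).
Proof.
rewrite /lift; case: ifP => xC; last by rewrite le_up_proj.
case: (low_or_up dbl v) => [{2}-> //|vE] /ltW; rewrite {1}vE (up_le_low dbl).
by rewrite xC andbT => /andP[_ /up_out <-]; rewrite -vE.
Qed.

(** Any [v < low x] lies under [lift x (p v)], itself strictly below [low x], so a lower cover must
    be such a lift. *)
Lemma lower_covers_low x :
  [set v | covered_by v (low x)] = lift x @: [set y | covered_by y x].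
Proof.
have liftE y z : (lift x y < lift x z) = (y < z).
  by rewrite /lift; case: ifP => _; [apply: low_ltE | apply: up_ltE].
have pliftE y : p (lift x y) = y by rewrite /lift; case: ifP => _.
apply/setP => v; rewrite inE; apply/covered_byP/imsetP.
- case=> vx vcov; have yx := lt_low_proj vx.
  have vE : v = lift x (p v).
    have := lt_low_lift vx; rewrite le_eqVlt => /orP[/eqP // | /vcov].
    by rewrite lift_lt_low => /(_ yx).
  exists (p v) => //; rewrite inE; apply/covered_byP; split=> // z yz zx.
  by apply: (vcov (lift x z)); rewrite ?lift_lt_low // vE liftE.
- case=> y; rewrite inE => /covered_byP[yx ycov] ->; split.
    by rewrite lift_lt_low.
  move=> w yw wx; have := proj_mono (ltW yw); rewrite pliftE le_eqVlt.
  case/orP=> [/eqP ywE|/ycov/(_ (lt_low_proj wx)) //].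
  by have := lt_low_lift wx; rewrite -ywE => /le_gtF; rewrite yw.
Qed.

Lemma lt_up_cases x v : v < up x ->
  v <= low x \/ [/\ v = up (p v), p v \in C & p v < x].
Proof.
case: (low_or_up dbl v) => vE; rewrite {1}vE.
  by move=> /ltW; rewrite (low_le_up dbl) => vx; left; rewrite vE (low_leE dbl).
rewrite up_ltE => vx; case: (boolP (p v \in C)) => vC; first by right.
by left; rewrite vE up_out // (low_leE dbl) ltW.
Qed.

(** The cover [low x] shuts off everything strictly below it; the other elements under [up x] are
    upper copies of points of [C], ordered as in [L]. *)
Lemma lower_covers_up x : x \in C ->
  [set v | covered_by v (up x)] =
  low x |: up @: [set y in C | covered_by y x].
Proof.
move=> xC; apply/setP => v; rewrite !inE; apply/covered_byP/orP.
- case=> vx vcov; case: (lt_up_cases vx) => [|[vE vC yx]].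
    rewrite le_eqVlt => /orP[|/vcov/(_ (low_lt_up xC)) //]; by left.
  right; apply/imsetP; exists (p v); rewrite // inE vC.
  apply/covered_byP; split=> // z yz zx.
  by apply: (vcov (up z)); rewrite 1?vE up_ltE.
- case=> [/eqP->|/imsetP[y]].
    split=> [|w xw /lt_up_cases[/le_gtF|[wE _]]]; first exact: low_lt_up.
      by rewrite xw.
    move: (ltW xw); rewrite wE (low_le_up dbl) => /le_gtF.
    by rewrite pu => ->.
  rewrite inE => /andP[yC /covered_byP[yx ycov]] ->.
  split=> [|w yw /lt_up_cases[wx|[wE _]]]; first by rewrite up_ltE.
    have := le_trans (ltW yw) wx.
    by rewrite (up_le_low dbl) xC yC andbF.
  by apply: ycov; rewrite -up_ltE -wE.
Qed.

Lemma low_inj : injective low. Proof. exact: can_inj pl. Qed.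
Lemma up_inj : injective up. Proof. exact: can_inj pu. Qed.

Lemma low_in_JIrr x : (low x \in JIrr D) = (x \in JIrr L).
Proof.
rewrite !inE lower_covers_low card_imset // /lift => y z.
by case: ifP => _; [apply: low_inj | apply: up_inj].
Qed.

(** Since [low x] is always a lower cover, [up x] is join-irreducible exactly when no lower cover of
    [x] lies in [C]. If some [y < x] is in [C], convexity puts a lower cover of [x] above [y] into
    [C] too. *)
Lemma up_in_JIrr x : convex C -> x \in C ->
  (up x \in JIrr D) = (x \in minimals C).
Proof.
move=> Cconv xC; rewrite inE lower_covers_up // cardsU1.
rewrite (_ : low x \notin _); last first.
  apply/imsetP => -[y]; rewrite !inE => /andP[_ /covered_byP[yx _]].
  by move=> /(congr1 p); rewrite pl pu => yE; rewrite yE ltxx in yx.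
rewrite card_imset; last exact: up_inj.
rewrite add1n eqSS cards_eq0; apply/eqP/minimalsP => [cov0|[_ xmin]].
  split=> // y yC; apply/negP => /cover_between[z yz zx].
  have : z \in [set y in C | covered_by y x].
    rewrite inE zx andbT; apply: (subsetP (Cconv y x yC xC)).
    by rewrite inE yz; case/covered_byP: zx => /ltW.
  by rewrite cov0 inE.
apply/setP => y; rewrite !inE; apply/negP => /andP[yC /covered_byP[yx _]].
by have := xmin y yC; rewrite yx.
Qed.

(** Lower copies of old join-irreducibles and upper copies of minimal elements of [C] exhaust the
    new ones, and do not overlap because the copies of a point of [C] differ. *)
Lemma card_JIrr_doubling : convex C ->
  #|JIrr D| = (#|JIrr L| + #|minimals C|)%N.
Proof.
move=> Cconv.
have minC x : x \in minimals C -> x \in C by case/minimalsP.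
have -> : JIrr D = low @: JIrr L :|: up @: minimals C.
  apply/setP => u; rewrite in_setU; apply/idP/orP => [uJ|].
    have low_case : u = low (p u) -> u \in low @: JIrr L.
      by move=> uE; rewrite uE imset_f // -low_in_JIrr -uE.
    case: (low_or_up dbl u) => uE; first by left; apply: low_case.
    have [uC|/up_out upE] := boolP (p u \in C).
      by right; rewrite uE imset_f // -up_in_JIrr // -uE.
    by left; apply: low_case; rewrite -upE.
  case=> /imsetP[x xJ ->]; first by rewrite low_in_JIrr.
  by rewrite up_in_JIrr // minC.
rewrite cardsU (_ : _ :&: _ = set0) ?cards0 ?subn0.
  by rewrite !card_imset //; [exact: up_inj | exact: low_inj].
apply/setP => u; rewrite !inE; apply/andP => -[/imsetP[x _ ->]].
case/imsetP=> y /minC yC xE; move: (congr1 p xE); rewrite pl pu => xyE.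
by move: (low_lt_up yC); rewrite -xE xyE ltxx.
Qed.

(** * Chains and length of a doubling *)

Lemma same_proj (T : {set D}) u v : u \in T -> v \in T -> u != v ->
  p u = p v -> [/\ p u \in C, low (p u) \in T & up (p u) \in T].
Proof.
move=> uT vT uv puv.
have uC : p u \in C.
  apply: contraR uv => /up_out upE.
  by case: (low_or_up dbl u) (low_or_up dbl v) => uE [] vE;
     rewrite uE vE -puv ?upE.
split=> //.
  case: (low_or_up dbl u) => [<- //|uE].
  case: (low_or_up dbl v) => vE; first by rewrite puv -vE.
  by rewrite uE vE puv eqxx in uv.
case: (low_or_up dbl u) => [uE|<- //].
case: (low_or_up dbl v) => vE; last by rewrite puv -vE.
by rewrite uE vE puv eqxx in uv.
Qed.

Lemma chain_proj (T : {set D}) : is_chain T -> is_chain (p @: T).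
Proof.
move=> /is_chainP Tch; apply/is_chainP => x y /imsetP[u uT ->] /imsetP[v vT ->].
by case/orP: (Tch _ _ uT vT) => /proj_mono h; rewrite /Order.comparable h ?orbT.
Qed.

(* Two distinct elements of [C] cannot both have their two copies in [T]: the
   upper copy of the smaller one and the lower copy of the larger one are
   incomparable. *)
Lemma chain_proj_card (T : {set D}) : is_chain T ->
  #|T| = #|p @: T| \/
  exists x, [/\ x \in C, x \in p @: T & (#|T| <= #|p @: T|.+1)%N].
Proof.
move=> /is_chainP Tch; have [|] := boolP (dinjectiveb p (mem T)).
  by move=> /dinjectiveP /card_in_imset ->; left.
case/dinjectivePn=> u uT [v /andP[/= vu vT] puv]; right; exists (p u).
have uv : u != v by rewrite eq_sym.
have [uC lT uT'] := same_proj uT vT uv puv.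
split=> //; first exact: imset_f.
(* Once [up (p u)] is removed, [p] is injective on the rest of [T]. *)
rewrite (cardsD1 (up (p u)) T) uT' add1n ltnS.
rewrite -(@card_in_imset _ _ p); first exact/subset_leq_card/imsetS/subsetDl.
move=> w w'; rewrite !in_setD1 => /andP[wu wT] /andP[w'u w'T] pww'.
apply/eqP; apply: contraT => ww'.
have [wC lwT uwT] := same_proj wT w'T ww' pww'.
(* Comparing each upper copy with the other lower copy gives both inequalities, as no upper copy of
   a point of [C] is below a lower copy of one. *)
have wuE : p w = p u.
  apply/le_anti; have := Tch _ _ lwT uT'; have := Tch _ _ uwT lT.
  rewrite /Order.comparable !(up_le_low dbl) !(low_le_up dbl) wC uC.
  by rewrite !andbF !orbF /= => -> ->.
case: (low_or_up dbl w) wu => [wE _|->]; last by rewrite wuE eqxx.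
case: (low_or_up dbl w') w'u => [w'E _|->]; last by rewrite -pww' wuE eqxx.
by rewrite wE w'E pww' eqxx in ww'.
Qed.

(** Climb by lower copies up to [low x], step to [up x], and continue by upper copies: [x] is used
    twice. *)
Lemma chain_through (S : {set L}) x : is_chain S -> x \in S -> x \in C ->
  exists2 T : {set D}, is_chain T & #|T| = #|S|.+1.
Proof.
move=> /is_chainP Sch xS xC.
pose g y := if y <= x then low y else up y.
have pg y : p (g y) = y by rewrite /g; case: ifP => _.
have g_mono y z : y <= z -> g y <= g z.
  rewrite /g => yz; case: ifPn => yx; case: ifPn => zx.
  - by rewrite (low_leE dbl).
  - by rewrite (low_le_up dbl).
  - by rewrite (le_trans yz zx) in yx.
  - by rewrite (up_leE dbl).
have g_cmp y z : y \in S -> z \in S -> g y >=< g z.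
  move=> yS zS; case/orP: (Sch _ _ yS zS) => /g_mono h;
  by rewrite /Order.comparable h ?orbT.
have ux_cmp y : y \in S -> up x >=< g y.
  move=> yS; rewrite /Order.comparable /g; case: ifPn => yx.
    by rewrite (low_le_up dbl) yx orbT.
  by rewrite !(up_leE dbl); apply: Sch.
exists (up x |: g @: S).
  apply/is_chainP => u v; rewrite !inE.
  case/orP=> [/eqP->|/imsetP[y yS ->]] /orP[/eqP->|/imsetP[z zS ->]].
  - exact: comparablexx.
  - exact: ux_cmp.
  - by rewrite comparable_sym ux_cmp.
  - exact: g_cmp.
rewrite cardsU1 card_imset; last exact: can_inj pg.
suff -> : up x \notin g @: S by [].
apply/imsetP => -[y _ xE]; have := congr1 p xE; rewrite pu pg => yE.
by have := low_lt_up xC; rewrite xE -yE /g lexx ltxx.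
Qed.

(** Projecting a chain loses at most one element, and only if the image meets [C]; if that image is
    a longest chain, [C] meets the spine. The lower bound comes from [chain_through], or from lower
    copies alone. *)
Lemma poset_length_doubling (x0 : L) :
  poset_length D = (poset_length L + ~~ [disjoint C & spine L])%N.
Proof.
apply/eqP; rewrite eqn_leq; apply/andP; split.
  apply: poset_length_le => T Tch; have pTch := chain_proj Tch.
  have pT_le := chain_card_le pTch.
  case: (chain_proj_card Tch) => [->|[x [xC xT T_le]]].
    by apply: leq_trans pT_le _; rewrite ltnS leq_addr.
  have [dis|_] := boolP [disjoint C & spine L]; last first.
    by rewrite addn1; apply: leq_trans T_le _; rewrite ltnS.
  rewrite addn0; apply: leq_trans T_le _.
  rewrite ltnS -ltnS ltn_neqAle pT_le andbT; apply/eqP => pTl.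
  have /(disjointFr dis)/negP := xC; apply; apply/spineP.
  by exists (p @: T).
have [dis|/pred0Pn[x /andP[/= xC /spineP[S [Sch Sl xS]]]]] :=
  boolP [disjoint C & spine L].
  have [S /is_chainP Sch Sl] := longest_chain x0.
  rewrite addn0 -ltnS -Sl -(card_imset S low_inj); apply: chain_card_le.
  apply/is_chainP => u v /imsetP[y yS ->] /imsetP[z zS ->].
  by rewrite /Order.comparable !(low_leE dbl); apply: Sch.
have [T Tch Tl] := chain_through Sch xS xC.
by rewrite addn1 -ltnS -Sl -Tl chain_card_le.
Qed.

End IsDoubling.

(** * Dual count, isomorphisms and the concrete doubling *)

Lemma card_MIrr_doubling d d' (L : finPOrderType d) (D : finPOrderType d')
    (C : {set L}) (p : D -> L) (low up : L -> D) :
  is_doubling C p low up -> convex C ->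
  #|MIrr D| = (#|MIrr L| + #|maximals C|)%N.
Proof.
move=> dbl Cconv; rewrite -!JIrr_dual -maximals_dual.
apply: (card_JIrr_doubling (doubling_dual dbl)) => x y xC yC.
apply: subset_trans (Cconv y x yC xC); apply/subsetP => z.
by rewrite !inE andbC.
Qed.

(** Invariance under isomorphism becomes the empty case of the doubling formulas. *)
Lemma iso_is_doubling d d' (S : finPOrderType d) (T : finPOrderType d') :
  order_isomorphic S T ->
  exists (p : T -> S) low up, is_doubling set0 p low up.
Proof.
case=> f [[g fK gK] f_mono]; exists g, f, f; split=> //.
- by move=> u; left; rewrite gK.
- by move=> x y; rewrite f_mono inE andbT.
Qed.

(** The copies of [x] take the least and the greatest admissible second coordinate: [false] and
    [true] on [C], twice [false] on the rest of the ideal, twice [true] outside it. *)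
Lemma doubling_is_doubling d (L : finPOrderType d) (D : finPOrderType d)
    (C : {set L}) : convex C -> order_isomorphic D (doubling C) ->
  exists (p : D -> L) low up, is_doubling C p low up.
Proof.
move=> Cconv [f [[g fK gK] f_mono]].
have C_ideal x : x \in C -> x \in order_ideal C.
  by move=> xC; rewrite inE; apply/existsP; exists x; rewrite xC /=.
have in_doubling x e : ((x, e) \in doubling_set C) =
    if e then (x \notin order_ideal C) || (x \in C) else x \in order_ideal C.
  rewrite in_setU !in_setX /= !in_set1 in_setU in_setC.
  by case: e; rewrite ?andbT ?andbF ?orbF.
have low_in x : (x, x \notin order_ideal C) \in doubling_set C.
  by rewrite in_doubling; case: (x \in order_ideal C).
have up_in x : (x, (x \notin order_ideal C) || (x \in C)) \in doubling_set C.
  rewrite in_doubling; case: (boolP (x \in C)) => [/C_ideal -> //|_].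
  by case: (x \in order_ideal C).
have leE (u v : doubling C) : (u <= v) =
   ((val u).1 <= (val v).1) && ((val u).2 ==> (val v).2).
  rewrite -[LHS]Order.le_val leEprod leEbool.
  by case: (val u).2; case: (val v).2.
have f_le x y : (g x <= g y) = (x <= y) by rewrite -f_mono !gK.
have ideal_le x y : x <= y -> y \in order_ideal C -> x \in order_ideal C.
  move=> xy; rewrite !inE => /existsP[z /andP[zC yz]].
  by apply/existsP; exists z; rewrite zC (le_trans xy yz).
(* Convexity enters here: within the ideal, whatever lies above a point of [C] is in [C]. *)
have C_up x y : x \in C -> x <= y -> y \in order_ideal C -> y \in C.
  move=> xC xy; rewrite inE => /existsP[z /andP[zC yz]].
  by apply: (subsetP (Cconv x z xC zC)); rewrite inE xy.
exists (fun u => (val (f u)).1).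
pose copy x e (xe : (x, e) \in doubling_set C) : doubling C :=
  exist (fun u => u \in doubling_set C) (x, e) xe.
exists (fun x => g (copy _ _ (low_in x))), (fun x => g (copy _ _ (up_in x))).
split.
- by move=> x; rewrite gK.
- by move=> x; rewrite gK.
- move=> u; case fE: (f u) => [[x e] xeP] /=.
  have eE : e = (x \notin order_ideal C) \/
            e = (x \notin order_ideal C) || (x \in C).
    move: {fE}(xeP); rewrite in_doubling.
    case: e {xeP}; case: (x \in order_ideal C); case: (x \in C) => //= _;
    by auto.
  by case: eE => eE; [left | right]; apply: (can_inj fK); rewrite fE gK;
     apply: val_inj; rewrite /= -eE.
- move=> x y; rewrite f_le leE /=; apply: andb_idr => xy.
  by apply/implyP; apply: contra; apply: ideal_le.
- move=> x y; rewrite f_le leE /=; apply: andb_idr => xy.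
  apply/implyP; case/orP=> [xI|xC]; first by rewrite (contra (ideal_le x y xy)).
  by have [/(C_up x y xC xy) ->|] := boolP (y \in order_ideal C); rewrite ?orbT.
- move=> x y; rewrite f_le leE /=; apply: andb_idr => xy.
  by apply/implyP => xI; rewrite (contra (ideal_le x y xy) xI).
- move=> x y; rewrite f_le leE /=; apply: andb_id2l => xy.
  (* For [x <= y] the relation fails only if the second coordinate drops from [true] to [false],
     which puts both points in [C]. *)
  have [yI|yI] := boolP (y \in order_ideal C).
    rewrite implybF negb_or negbK (ideal_le x y xy yI) /=.
    by case: (boolP (x \in C)) => //= xC; rewrite (C_up x y xC xy yI).
  by rewrite implybT (contraNF (C_ideal y) yI) andbF.
Qed.

Lemma iso_invariants d d' (S : finPOrderType d) (T : finPOrderType d')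
    (x0 : S) :
  order_isomorphic S T ->
  [/\ poset_length T = poset_length S, #|JIrr T| = #|JIrr S|
    & #|MIrr T| = #|MIrr S|].
Proof.
move=> /iso_is_doubling[p [low [up dbl]]].
have conv0 : convex (set0 : {set S}) by move=> x y; rewrite inE.
have min0 : minimals (set0 : {set S}) = set0.
  by apply/setP => x; rewrite !inE.
have max0 : maximals (set0 : {set S}) = set0.
  by apply/setP => x; rewrite !inE.
rewrite (poset_length_doubling dbl x0) (card_JIrr_doubling dbl conv0).
rewrite (card_MIrr_doubling dbl conv0) min0 max0 cards0 !addn0.
by rewrite (_ : [disjoint _ & _]) ?addn0 //; apply/pred0P => x; rewrite /= inE.
Qed.

Lemma subsingleton_invariants d (L : finPOrderType d) : (#|L| <= 1)%N ->
  [/\ poset_length L = 0%N, #|JIrr L| = 0%N & #|MIrr L| = 0%N].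
Proof.
move=> /card_le1_eqP L1; split.
- apply/eqP; rewrite -leqn0; apply: poset_length_le => S _.
  by apply/card_le1_eqP => x y _ _; apply: L1.
- apply: eq_card0 => x; rewrite !inE; apply/negP => /cards1P[y] /setP/(_ y).
  by rewrite !inE eqxx (L1 x y) // /covered_by ltxx.
- apply: eq_card0 => x; rewrite !inE; apply/negP => /cards1P[y] /setP/(_ y).
  by rewrite !inE eqxx (L1 x y) // /covered_by ltxx.
Qed.

End Doublings.

(** * Comparison of sums along a doubling sequence *)

Lemma sum_eq_iff_all1 m (e n : nat -> nat) :
  (forall i, i < m -> e i <= 1) -> (forall i, i < m -> 0 < n i) ->
  \sum_(i < m) e i = \sum_(i < m) n i <->
  forall i, i < m -> e i = 1 /\ n i = 1.
Proof.
move=> e1 n1.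
(* Here [e i <= 1 <= n i], so equal terms are both 1, and equal sums force equality in every
   term. *)
have en (i : 'I_m) : true -> e i <= n i ?= iff (e i == 1) && (n i == 1).
  move=> _; apply/leqifP; move: (e1 i (ltn_ord i)) (n1 i (ltn_ord i)).
  by case: (e i) => [|[|]] //; case: (n i) => [|[|]].
have [_ sumE] := leqif_sum en; split.
  move/eqP; rewrite sumE => /forallP h i im.
  by have /andP[/eqP ? /eqP] := h (Ordinal im).
move=> h; apply/eqP; rewrite sumE; apply/forallP => i.
by case: (h i _) => // -> ->.
Qed.

Lemma sequence_invariants {d : Order.disp_t} {L : finTBLatticeType d}
    {m : nat} {Ls : nat -> finTBLatticeType d} {C : forall i, {set Ls i}} :
  doubling_sequence m C L ->
  [/\ poset_length L = \sum_(i < m) ~~ [disjoint C i & spine (Ls i)],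
      #|JIrr L| = \sum_(i < m) #|minimals (C i)|
    & #|MIrr L| = \sum_(i < m) #|maximals (C i)|].
Proof.
(* The final isomorphism moves the claim to [Ls m], where induction on [m] applies; [\bot] only
   witnesses non-emptiness. *)
case=> L0 _ Cconv step /(iso_invariants \bot%O)[-> -> ->].
elim: m Cconv step => [|m IHm] Cconv step.
  by rewrite !big_ord0; apply: subsingleton_invariants; rewrite L0.
rewrite !big_ord_recr /=.
have [i im|i im|<- <- <-] := IHm; first exact/Cconv/ltnW.
  exact/step/ltnW.
have Cmconv := Cconv m (ltnSn m).
have [p [low [up dbl]]] := doubling_is_doubling Cmconv (step m (ltnSn m)).
split; last exact: card_MIrr_doubling dbl Cmconv.
  exact: poset_length_doubling dbl \bot%O.
exact: card_JIrr_doubling dbl Cmconv.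
Qed.

Theorem proposition3p5 (d : Order.disp_t) (L : finTBLatticeType d)
    (m : nat) (Ls : nat -> finTBLatticeType d) (C : forall i : nat, {set Ls i})
    (L_normal : congruence_normal L)
    (LsC : doubling_sequence m C L) :
  (join_extremal L <->
     join_congruence_uniform L /\
     forall i : nat, i < m ->
       lower_pseudo_interval (C i) /\ exists2 x, x \in C i & x \in spine (Ls i))
  /\
  (extremal L <->
     congruence_uniform L /\
     forall i : nat, i < m ->
       is_interval (C i) /\ exists2 x, x \in C i & x \in spine (Ls i)).
Proof.
have [len_L JIrr_L MIrr_L] := sequence_invariants LsC.
have [_ C0 Cconv _ _] := LsC.
have spine1 i : nat_of_bool (~~ [disjoint C i & spine (Ls i)]) = 1 <->
    exists2 x, x \in C i & x \in spine (Ls i).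
  split=> [|[x xC xs]].
    by case: (boolP [disjoint _ & _]) => // /pred0Pn[x /andP[]]; exists x.
  by apply/eqP; rewrite eqb1; apply/pred0Pn; exists x; rewrite /= xC xs.
have spine_le1 i : i < m -> ~~ [disjoint C i & spine (Ls i)] <= 1.
  by move=> _; apply: leq_b1.
have lpiP i (im : i < m) :=
  lower_pseudo_intervalP (C0 i im) (Cconv i im).
have joinP : join_extremal L <-> forall i, i < m ->
    lower_pseudo_interval (C i) /\ exists2 x, x \in C i & x \in spine (Ls i).
  (* Spine indicators, at most 1, are weighed against numbers of minimal elements, at least 1 since
     [C i] is non-empty. *)
  have minP := sum_eq_iff_all1 spine_le1
                 (fun i im => card_minimals_gt0 (C0 i im)).
  rewrite /join_extremal len_L JIrr_L.
  split=> [/minP|] h; [|apply/minP] => i im; have [h1 h2] := h i im; split.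
  - exact/(lpiP i im).
  - exact/spine1.
  - exact/spine1.
  - exact/(lpiP i im).
have meetP : meet_extremal L <-> forall i, i < m ->
    nat_of_bool (~~ [disjoint C i & spine (Ls i)]) = 1 /\ #|maximals (C i)| = 1.
  rewrite /meet_extremal len_L MIrr_L.
  exact: sum_eq_iff_all1 spine_le1 (fun i im => card_maximals_gt0 (C0 i im)).
have extP : extremal L <-> forall i, i < m ->
    is_interval (C i) /\ exists2 x, x \in C i & x \in spine (Ls i).
  have itvP i (im : i < m) := is_intervalP (Cconv i im).
  (* Join-extremality supplies the least element of [C i], meet-extremality the greatest. *)
  split=> [[/joinP jP /meetP mP] i im|h].
    have [/(lpiP i im) min1 s1] := jP i im; have [_ max1] := mP i im.
    by split=> //; apply/(itvP i im).
  split; [apply/joinP | apply/meetP] => i im;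
    have [/(itvP i im)[min1 max1] s1] := h i im; split=> //.
    exact/(lpiP i im).
  exact/spine1.
split.
  split=> [/joinP h|[_ /joinP //]]; split=> //.
  (* The given sequence itself witnesses uniformity. *)
  by exists m, Ls, C; split=> // i /h[].
split=> [/extP h|[_ /extP //]]; split=> //.
by exists m, Ls, C; split=> // i /h[].
Qed.
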